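(* As formal power series in $q$ (equivalently for $|q|<1$), $$\sum_{m,n\geq 0} \frac{q^{2m^2 + 6mn +6n^2 -2m-3n}}{(q;q)_m(q^3;q^3)_n} = (-q^2,-q^4;q^6)_\infty(-q^3;q^3)_\infty + (-q,-q^5;q^6)_\infty(-q^3;q^3)_\infty .$$
   Context: $(a;q)_n=\prod_{i=0}^{n-1}(1-aq^i)$, $(a;q)_\infty=\prod_{i\ge0}(1-aq^i)$, and $(a_1,\dots,a_k;q)_\infty=(a_1;q)_\infty\cdots(a_k;q)_\infty$. *)

(* Defs.v *)
From HB Require Import structures.
From mathcomp Require Import all_boot all_order all_algebra.
From mathcomp Require Import boolp zify.

Set Implicit Arguments.
Unset Strict Implicit.
Unset Printing Implicit Defensive.
Import Order.TTheory GRing.Theory Num.Theory.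
Local Open Scope ring_scope.

(* A record rather than the bare type [nat -> R], on which [boolp] already
   provides structures. *)

Record fps (R : Type) : Type := FPS { coef : nat -> R }.

HB.instance Definition _ (R : Type) := gen_eqMixin (fps R).
HB.instance Definition _ (R : Type) := gen_choiceMixin (fps R).

Lemma fpsP (R : Type) (f g : fps R) : coef f =1 coef g <-> f = g.
Proof.
split=> [|-> //]; case: f g => [f] [g] /= /funext fg; by rewrite fg.
Qed.

Section Ring.
Variable R : comNzRingType.
Implicit Types f g h : fps R.

Definition fps_zero : fps R := FPS (fun=> 0).
Definition fps_opp f : fps R := FPS (fun k => - coef f k).
Definition fps_add f g : fps R := FPS (fun k => coef f k + coef g k).
Definition fps_one : fps R := FPS (fun k => (k == 0%N)%:R).
Definition fps_mul f g : fps R :=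
  FPS (fun k => \sum_(i < k.+1) coef f i * coef g (k - i)).

Lemma fps_addA : associative fps_add.
Proof. by move=> f g h; apply/fpsP => k /=; rewrite addrA. Qed.

Lemma fps_addC : commutative fps_add.
Proof. by move=> f g; apply/fpsP => k /=; rewrite addrC. Qed.

Lemma fps_add0 : left_id fps_zero fps_add.
Proof. by move=> f; apply/fpsP => k /=; rewrite add0r. Qed.

Lemma fps_addN : left_inverse fps_zero fps_opp fps_add.
Proof. by move=> f; apply/fpsP => k /=; rewrite addNr. Qed.

HB.instance Definition _ :=
  GRing.isZmodule.Build (fps R) fps_addA fps_addC fps_add0 fps_addN.

Let trunc N f : {poly R} := \poly_(i < N.+1) coef f i.

Let coef_trunc N f i : (i <= N)%N -> coef f i = (trunc N f)`_i.
Proof. by move=> iN; rewrite coef_poly ltnS iN. Qed.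

Let coef_mul_poly N f g (p r : {poly R}) k : (k <= N)%N ->
    (forall i, (i <= N)%N -> coef f i = p`_i) ->
    (forall i, (i <= N)%N -> coef g i = r`_i) ->
  coef (fps_mul f g) k = (p * r)`_k.
Proof.
move=> kN fp gr; rewrite coefM /=; apply: eq_bigr => -[i /= ik] _.
rewrite fp ?gr //; first exact: leq_trans (leq_subr _ _) kN.
exact: leq_trans kN.
Qed.

Let coef_mul_trunc N f g k : (k <= N)%N ->
  coef (fps_mul f g) k = (trunc N f * trunc N g)`_k.
Proof. by move=> kN; apply: (coef_mul_poly kN) => i; apply: coef_trunc. Qed.

Lemma fps_mulA : associative fps_mul.
Proof.
move=> f g h; apply/fpsP => k.
rewrite (@coef_mul_poly k f _ (trunc k f) (trunc k g * trunc k h)) //.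
- rewrite mulrA; symmetry.
  apply: (@coef_mul_poly k) => // i ik; last exact: coef_trunc.
  exact: coef_mul_trunc.
- exact: coef_trunc.
- by move=> i ik; apply: coef_mul_trunc.
Qed.

Lemma fps_mulC : commutative fps_mul.
Proof.
by move=> f g; apply/fpsP => k; rewrite !(@coef_mul_trunc k) // mulrC.
Qed.

Lemma fps_mul1 : left_id fps_one fps_mul.
Proof.
move=> f; apply/fpsP => k /=.
rewrite big_ord_recl /= mul1r subn0 big1 ?addr0 // => i _.
by rewrite mul0r.
Qed.

Lemma fps_mulDl : left_distributive fps_mul fps_add.
Proof.
move=> f g h; apply/fpsP => k /=; rewrite -big_split /=.
by apply: eq_bigr => i _; rewrite mulrDl.
Qed.

Lemma fps_one_neq0 : fps_one != fps_zero.
Proof.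
apply/eqP => /(congr1 (fun f => coef f 0%N)) /= /eqP.
by rewrite oner_eq0.
Qed.

HB.instance Definition _ := GRing.Zmodule_isComNzRing.Build (fps R)
  fps_mulA fps_mulC fps_mul1 fps_mulDl fps_one_neq0.

Definition fpsX : fps R := FPS (fun k => (k == 1%N)%:R).

Lemma coef0 k : coef (0 : fps R) k = 0. Proof. by []. Qed.
Lemma coef1 k : coef (1 : fps R) k = (k == 0%N)%:R. Proof. by []. Qed.
Lemma coefD f g k : coef (f + g) k = coef f k + coef g k. Proof. by []. Qed.
Lemma coefN f k : coef (- f) k = - coef f k. Proof. by []. Qed.
Lemma coefB f g k : coef (f - g) k = coef f k - coef g k. Proof. by []. Qed.
Lemma coefM f g k :
  coef (f * g) k = \sum_(i < k.+1) coef f i * coef g (k - i).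
Proof. by []. Qed.

Lemma coefX k : coef fpsX k = (k == 1%N)%:R. Proof. by []. Qed.

#[global] Arguments coef : simpl never.

Lemma coef_sum I (r : seq I) (P : pred I) (F : I -> fps R) k :
  coef (\sum_(i <- r | P i) F i) k = \sum_(i <- r | P i) coef (F i) k.
Proof.
by apply: (big_morph (fun f => coef f k)) => [f g|]; rewrite ?coefD ?coef0.
Qed.

Lemma coefM0 f g : coef (f * g) 0 = coef f 0 * coef g 0.
Proof. by rewrite coefM big_ord_recl big_ord0 addr0. Qed.

Lemma coef_fpsXn n k : coef (fpsX ^+ n) k = (k == n)%:R.
Proof.
elim: n k => [|n IHn] k; first by rewrite expr0 coef1.
rewrite exprS coefM; case: k => [|k].
  by rewrite big_ord_recl big_ord0 coefX mul0r addr0.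
rewrite 2!big_ord_recl big1 => [|i _]; last by rewrite coefX mul0r.
by rewrite !coefX mul0r mul1r add0r addr0 IHn /bump /= subSS subn0 eqSS.
Qed.

Lemma coefXn_small f j k : coef f 0 = 0 -> (k < j)%N -> coef (f ^+ j) k = 0.
Proof.
move=> f0; elim: j k => // j IHj k kj; rewrite exprS coefM big1 // => i _.
case: (posnP i) => [->|i0]; first by rewrite f0 mul0r.
by rewrite IHj ?mulr0 //; have := ltn_ord i; lia.
Qed.

End Ring.

Arguments fpsX {R}.

Section UnitRing.
Variable R : comUnitRingType.
Implicit Types f g : fps R.

Definition fps_unit : {pred fps R} := fun f => coef f 0 \is a GRing.unit.

(* With [u] the constant term of [f], [1 / f] is the geometric series
   [u^-1 * \sum_j (1 - u^-1 * f) ^+ j], whose terms of index [j > k] do not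
   contribute to the coefficient of index [k]. *)
Definition fps_const (c : R) : fps R := FPS (fun k => if k == 0%N then c else 0).
Definition fps_geom f : fps R := FPS (fun k => coef (\sum_(j < k.+1) f ^+ j) k).
Definition fps_inv f : fps R :=
  if f \in fps_unit then
    let c := fps_const (coef f 0)^-1 in c * fps_geom (1 - c * f)
  else f.

Lemma fps_geomK f : coef f 0 = 0 -> (1 - f) * fps_geom f = 1.
Proof.
move=> f0; apply/fpsP => k.
have geomE i : (i <= k)%N ->
    coef (fps_geom f) i = coef (\sum_(j < k.+1) f ^+ j) i.
  move=> ik; rewrite {1}/coef /= !coef_sum.
  rewrite -!(big_mkord xpredT (fun j => coef (f ^+ j) i)).
  rewrite [RHS](big_cat_nat (n := i.+1)) //=.
  rewrite [X in _ = _ + X]big_nat_cond [X in _ = _ + X]big1 ?addr0 //.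
  by move=> j /andP[/andP[ij _] _]; apply: coefXn_small.
transitivity (coef ((1 - f) * \sum_(j < k.+1) f ^+ j) k).
  by rewrite !coefM; apply: eq_bigr => i _; rewrite geomE // leq_subr.
rewrite -[1 - f]opprB mulNr -subrX1 opprB coefB.
by rewrite (coefXn_small f0) ?subr0.
Qed.

Lemma fps_mulVx : {in fps_unit, left_inverse 1 fps_inv *%R}.
Proof.
move=> f fU; rewrite /fps_inv fU /= mulrAC.
set c := fps_const _; have := @fps_geomK (1 - c * f).
rewrite subKr; apply; rewrite coefB coefM0 coef1 /= mulVr ?subrr //.
Qed.

Lemma fps_unitPl f g : g * f = 1 -> fps_unit f.
Proof.
move=> /(congr1 (fun h => coef h 0)); rewrite coefM0 coef1 /= => gf.
by apply/unitrPr; exists (coef g 0); rewrite mulrC.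
Qed.

Lemma fps_inv_out : {in [predC fps_unit], fps_inv =1 id}.
Proof. by move=> f /negbTE fU; rewrite /fps_inv fU. Qed.

HB.instance Definition _ := GRing.ComNzRing_hasMulInverse.Build (fps R)
  fps_mulVx fps_unitPl fps_inv_out.

Lemma unit_fpsE f : (f \is a GRing.unit) = (coef f 0 \is a GRing.unit).
Proof. by []. Qed.

End UnitRing.

Definition fps_cvg (R : Type) (u : nat -> fps R) (f : fps R) : Prop :=
  forall k, exists N, forall n, (N <= n)%N -> coef (u n) k = coef f k.

(* Each coefficient receives finitely many contributions, so the order of
   summation is irrelevant. *)
Definition fps_has_sum2 (R : comNzRingType) (F : nat -> nat -> fps R)
    (S : fps R) : Prop :=
  forall k, exists N,
    (forall m n, (N <= m)%N || (N <= n)%N -> coef (F m n) k = 0) /\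
    coef S k = \sum_(m < N) \sum_(n < N) coef (F m n) k.

Lemma fps_has_sum2_uniq (R : comNzRingType) (F : nat -> nat -> fps R) S S' :
  fps_has_sum2 F S -> fps_has_sum2 F S' -> S = S'.
Proof.
have widen k N M : (N <= M)%N ->
    (forall m n, (N <= m)%N || (N <= n)%N -> coef (F m n) k = 0) ->
    \sum_(m < N) \sum_(n < N) coef (F m n) k =
    \sum_(m < M) \sum_(n < M) coef (F m n) k.
  move=> NM F0; rewrite -(subnKC NM) big_split_ord /=.
  rewrite [X in _ = _ + X]big1 ?addr0 => [|i _]; last first.
    by rewrite big1 // => j _; rewrite F0 // leq_addr.
  apply: eq_bigr => i _; rewrite big_split_ord /=.
  rewrite [X in _ = _ + X]big1 ?addr0 // => j _.
  by rewrite F0 // leq_addr orbT.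
move=> FS FS'; apply/fpsP => k.
have [N [F0 ->]] := FS k; have [N' [F0' ->]] := FS' k.
by rewrite (widen _ _ (maxn N N')) ?leq_maxl // [RHS](widen _ _ (maxn N N'))
  ?leq_maxr.
Qed.

(* (a; q)_n *)
Definition qpoch (A : pzRingType) (a q : A) (n : nat) : A :=
  \prod_(i < n) (1 - a * q ^+ i).

(* [qpoch_inf a q] is (a; q)_oo, for [q] without constant term: the factors of
   index [i > k] do not contribute to the coefficient of index [k]. *)
Definition qpoch_inf (R : comNzRingType) (a q : fps R) : fps R :=
  FPS (fun k => coef (qpoch a q k.+1) k).

Lemma qpoch_inf_cvg (R : comNzRingType) (a q : fps R) :
  coef q 0 = 0 -> fps_cvg (qpoch a q) (qpoch_inf a q).
Proof.
move=> q0 k; exists k.+1; elim=> // n IHn; rewrite leq_eqVlt => /orP[/eqP<-//|].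
rewrite ltnS => kn; rewrite -IHn // /qpoch big_ord_recr /= mulrBr mulr1 coefB.
rewrite mulrA coefM [X in _ - X]big1 ?subr0 // => i _.
by rewrite (coefXn_small q0) ?mulr0 // (leq_ltn_trans (leq_subr _ _)).
Qed.

(* (a_1, ..., a_k; q)_oo *)
Definition qpochs_inf (R : comNzRingType) (s : seq (fps R)) (q : fps R) : fps R :=
  \prod_(a <- s) qpoch_inf a q.

(* The denominators (q^d; q^d)_n are invertible, hence [/] is a true division. *)
Lemma qpoch_fpsX_unit (R : comUnitRingType) (d n : nat) : (0 < d)%N ->
  qpoch (fpsX ^+ d) (fpsX ^+ d) n \is a @GRing.unit (fps R).
Proof.
case: d => // d _; apply: rpred_prod => i _; rewrite unit_fpsE coefB coef1 coefM0.
by rewrite coef_fpsXn mul0r subr0 unitr1.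
Qed.

(* No truncation occurs in this natural number exponent. *)
Lemma exponentE (m n : nat) :
  (2 * m ^ 2 + 6 * m * n + 6 * n ^ 2 - 2 * m - 3 * n)%N%:Z =
  2 * m%:Z ^+ 2 + 6 * m%:Z * n%:Z + 6 * n%:Z ^+ 2 - 2 * m%:Z - 3 * n%:Z.
Proof.
have : (m <= m ^ 2)%N by rewrite -mulnn; case: m => // m; rewrite leq_pmulr.
have : (n <= n ^ 2)%N by rewrite -mulnn; case: n => // n; rewrite leq_pmulr.
rewrite -!mulnn -!mulnA -!mulrA !expr2; lia.
Qed.

(* Main.v *)
(* Write T(a, b) for the double sum with a m + b n added to the exponent of q.
   Shifting m or n by one gives
     T(a, b) - T(a + 1, b) = q^a T(a + 4, b + 6),
     T(a, b) - T(a, b + 3) = q^(b + 3) T(a + 6, b + 12),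
   so that A_n = T(3n + 2, 6n + 3) and B_n = T(3n + 3, 6n + 6), the generating
   functions of Capparelli's partitions with parts at least 3n + 2 and 3n + 3,
   satisfy a linear system of order three, and T(0, 0) = A_0 + B_0 + q A_1.
   With Q = q^3, a solution of the adjoint system is given by the polynomials
     u_n = sum_k [n choose k]_Q Q^C(n - k, 2) p_k,
   where p_k is (-q^2,-q^4;q^6)_j for k = 2j and (-q;q^6)_(j+1) (-q^5;q^6)_j for
   k = 2j + 1. The pairing of both solutions does not depend on n: it starts at
   T(0, 0) and, since A_n and B_n tend to 1, it tends to lim u_n. There p_k may
   be replaced by its limits over even and odd k, and for a 2-periodic sequence
   c the sum is (c_0 + c_1) (-Q;Q)_(n-1) by the q-binomial theorem. *)
Require Import Defs.
From mathcomp Require Import all_boot all_order all_algebra.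
From mathcomp Require Import ring zify.

Set Implicit Arguments.
Unset Strict Implicit.
Unset Printing Implicit Defensive.
Import GRing.Theory.
Local Open Scope ring_scope.

Lemma qpochS (A : pzRingType) (a q : A) n :
  qpoch a q n.+1 = qpoch a q n * (1 - a * q ^+ n).
Proof. by rewrite /qpoch big_ord_recr. Qed.

(** * Gaussian binomial coefficients and sums weighted by them *)

Section GaussianSums.
Variables (R : comNzRingType) (Q : R).

Fixpoint qbin (n k : nat) : R :=
  match n, k with
  | _, 0 => 1
  | 0, _.+1 => 0
  | n'.+1, k'.+1 => qbin n' k' + Q ^+ k'.+1 * qbin n' k'.+1
  end.

Lemma qbin0 n : qbin n 0 = 1. Proof. by case: n. Qed.

Lemma qbinS n k : qbin n.+1 k.+1 = qbin n k + Q ^+ k.+1 * qbin n k.+1.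
Proof. by []. Qed.

Lemma qbin_small n k : (n < k)%N -> qbin n k = 0.
Proof.
elim: n k => [|n IHn] [|k] //= nk; rewrite !IHn ?mulr0 ?addr0 //; lia.
Qed.

(** The ratio of neighbouring Gaussian binomials, free of division because [R] is an arbitrary
    ring. *)
Lemma qbin_ratio n k : (k <= n)%N ->
  (1 - Q ^+ k.+1) * qbin n k.+1 = (1 - Q ^+ (n - k)) * qbin n k.
Proof.
elim: n k => [|n IHn] [|k] // kn.
- by rewrite /= subrr mul0r mulr0.
- rewrite qbinS !qbin0 mulr1 subn0 mulrDr mulr1 mulrCA IHn // subn0 qbin0 [Q ^+ n.+1]exprS; ring.
- rewrite !qbinS subSS [RHS]mulrDr -IHn //.
  have {kn} [kn|->] : (k < n)%N \/ k = n by lia.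
    have IHk := IHn k.+1 kn.
    have e : (n - k = (n - k.+1).+1)%N by lia.
    rewrite mulrDr (mulrCA _ (Q ^+ k.+2)) IHk e !exprS; ring.
  by rewrite (qbin_small (ltnSn n)) (qbin_small (leqnSn n.+1)) subnn; ring.
Qed.

Lemma qbin_absorb n k : (k <= n)%N ->
  (1 - Q ^+ k.+1) * qbin n.+1 k.+1 = (1 - Q ^+ n.+1) * qbin n k.
Proof.
move=> kn; rewrite qbinS mulrDr mulrCA qbin_ratio //.
have -> : n.+1 = (k.+1 + (n - k))%N by lia.
by rewrite exprD; ring.
Qed.

Lemma qbinS_rev n k : (k <= n)%N ->
  qbin n.+1 k.+1 = Q ^+ (n - k) * qbin n k + qbin n k.+1.
Proof.
move=> kn; rewrite qbinS; apply/eqP; rewrite -subr_eq0; apply/eqP.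
transitivity ((1 - Q ^+ (n - k)) * qbin n k - (1 - Q ^+ k.+1) * qbin n k.+1).
  by ring.
by rewrite qbin_ratio // subrr.
Qed.

Lemma qbin_absorb_rev n k : (k <= n)%N ->
  (1 - Q ^+ (n - k).+1) * qbin n.+1 k = (1 - Q ^+ n.+1) * qbin n k.
Proof.
by move=> kn; rewrite -subSn // -qbin_ratio ?leqW // qbin_absorb.
Qed.

Definition gsum (c : nat -> R) (n : nat) : R :=
  \sum_(k < n.+1) qbin n k * Q ^+ 'C(n - k, 2) * c k.

Lemma gsum0 c : gsum c 0 = c 0%N.
Proof. by rewrite /gsum big_ord1 /= expr0 !mul1r. Qed.

(** In the second half of Pascal's rule, $Q^k$ and the factor $Q^{n-k}$ from the binomial exponent
    combine to $Q^n$ for every $k$. *)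
Lemma gsumS c n : gsum c n.+1 = gsum (c \o S) n + Q ^+ n * gsum c n.
Proof.
rewrite {1}/gsum big_ord_recl /=.
under eq_bigr => k _.
  rewrite /bump /= add1n subSS !mulrDl; over.
rewrite big_split /= addrCA; congr (_ + _).
rewrite subn0 binS bin1 exprD mul1r big_ord_recr /= qbin_small // mulr0 !mul0r addr0.
rewrite /gsum mulr_sumr big_ord_recl qbin0 subn0 mul1r /=; congr (_ + _).
  by rewrite mulrAC mulrC mulrA.
apply: eq_bigr => k _; rewrite /bump /= add1n.
have kn := ltn_ord k.
have e : (n - k = (n - k.+1).+1)%N by lia.
rewrite e binS bin1 exprD.
have -> : Q ^+ n = Q ^+ k.+1 * Q ^+ (n - k.+1) by rewrite -exprD; congr (_ ^+ _); lia.
by ring.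
Qed.

(** Shifting [c] swaps its two values, so each use of [gsumS] contributes a factor $1 + Q^{n+1}$. *)
Lemma gsum_periodic c n : (forall k, c k.+2 = c k) ->
  gsum c n.+1 = (c 0%N + c 1%N) * qpoch (- Q) Q n.
Proof.
elim: n c => [|n IHn] c cS.
  by rewrite gsumS !gsum0 /qpoch big_ord0 /= mul1r mulr1 addrC.
rewrite gsumS (IHn c cS) IHn /=; last by move=> k; rewrite /= cS.
rewrite cS qpochS exprS /=; ring.
Qed.

End GaussianSums.

Arguments qbin : simpl never.

(** * The polynomials $p_k$ and $u_n$, and the recurrence of $u_n$ *)

Section Capparelli.
Variables (R : comNzRingType) (q : R).
Let Q := q ^+ 3.

Fixpoint capp (k : nat) : R :=
  match k with
  | 0 => 1
  | 1 => 1 + q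
  | k'.+2 => (1 + q ^+ (3 * k' + 2)) * (1 + q ^+ (3 * k' + 4)) * capp k'
  end.

Lemma cappE k :
  capp k.+2 = (1 + q ^+ (3 * k + 2)) * (1 + q ^+ (3 * k + 4)) * capp k.
Proof. by []. Qed.

Arguments capp : simpl never.

(** The value $q$ at 0 makes the terms of index 0 agree in [capu_rec], as $q^2 q = Q$. *)
Definition cappS (k : nat) : R := if k is k'.+1 then (1 + q) * capp k' else q.

Definition capu := gsum Q capp.
Definition capw := gsum Q cappS.

(** With $x = Q^k$: $(1+q^2x)(1+q^4x) = (1-Qx)^2 + q^2(1+q)^2x$. *)
Lemma cappSS k :
  q ^+ 2 * (1 + q) ^+ 2 * Q ^+ k * capp k
  = capp k.+2 - (1 - Q ^+ k.+1) ^+ 2 * capp k.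
Proof.
rewrite cappE !(exprD _ (3 * k)) (exprM q 3) -/Q [Q ^+ k.+1]exprS; set x := Q ^+ k.
have -> : q ^+ 4 = Q * q by rewrite /Q -exprSr.
rewrite /Q; ring.
Qed.

Lemma capwS n : capw n.+1 = (1 + q) * capu n + Q ^+ n * capw n.
Proof.
rewrite /capw gsumS; congr (_ + _).
rewrite /capu /gsum mulr_sumr; apply: eq_bigr => k _ /=; ring.
Qed.


Lemma capu_rec n :
  capu n.+2 - capu n.+1 + Q ^+ n.+1 * (1 - Q ^+ n.+1) * capu n
  = (1 + q) * q ^+ 2 * Q ^+ n * capw n.+1.
Proof.
pose f k := qbin Q n.+1 k * Q ^+ 'C(n.+1 - k, 2).
(* The reversed Pascal rule isolates the sum over [capp k.+1] that reappears in [wsplit]. *)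
have usplit : capu n.+2 = \sum_(k < n.+2) Q ^+ (n.+1 - k) * f k * capp k.+1
    + \sum_(k < n.+2) qbin Q n.+1 k * Q ^+ 'C(n.+2 - k, 2) * capp k.
  rewrite /capu /gsum big_ord_recl /= qbin0.
  under eq_bigr => k _.
    rewrite /bump [(1 + k)%N]/= add1n subSS qbinS_rev; last by rewrite -ltnS.
    rewrite 2!mulrDl; over.
  rewrite big_split /= addrCA; congr (_ + _).
    by apply: eq_bigr => k _; rewrite /f; ring.
  rewrite [X in _ + X]big_ord_recr /= qbin_small // !mul0r addr0.
  rewrite [RHS]big_ord_recl qbin0 /=; congr (_ + _).
have wsplit : (1 + q) * q ^+ 2 * Q ^+ n * capw n.+1
    = \sum_(k < n.+2) Q ^+ (n.+1 - k) * f k * capp k.+1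
    - \sum_(k < n.+1) Q ^+ (n - k) * f k.+1 * (1 - Q ^+ k.+1) ^+ 2 * capp k.
  rewrite /capw /gsum big_ord_recl [in RHS]big_ord_recl mulrDr -addrA.
  congr (_ + _); first by rewrite /f !subn0 [Q ^+ n.+1]exprS /capp /= /Q; ring.
  rewrite mulr_sumr -sumrB; apply: eq_bigr => k _.
  rewrite lift0 /f !subSS /cappS.
  have kn := ltn_ord k.
  have -> : Q ^+ n = Q ^+ (n - k) * Q ^+ k by rewrite -exprD; congr (_ ^+ _); lia.
  transitivity (Q ^+ (n - k) * (qbin Q n.+1 k.+1 * Q ^+ 'C(n - k, 2))
      * (q ^+ 2 * (1 + q) ^+ 2 * Q ^+ k * capp k)); first by ring.
  by rewrite cappSS; ring.
(* The common sum cancels and the coefficients of [capp k] are compared; both absorption rules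
   reduce them to [qbin Q n k]. *)
rewrite usplit wsplit -!addrA; congr (_ + _).
rewrite /capu /gsum addrA -sumrB big_ord_recr /= subnn subSnn !expr0 subrr addr0.
rewrite mulr_sumr -big_split -sumrN; apply: eq_bigr => k _ /=.
have kn : (k <= n)%N by rewrite -ltnS.
rewrite /f subSS !subSn ?leqW // !binS !bin1 bin0 !exprD !expr1.
have ab1 := qbin_absorb Q kn; have ab2 := qbin_absorb_rev Q kn.
set e := Q ^+ 'C(n - k, 2); set p := capp k; set x := Q ^+ (n - k).
have xE : Q ^+ n.+1 = x * Q ^+ k.+1 by rewrite -exprD; congr (_ ^+ _); lia.
set B := qbin Q n.+1 k in ab2 *; set C := qbin Q n.+1 k.+1 in ab1 *; set D := qbin Q n k in ab1 ab2 *.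
transitivity (e * p * (- x * ((1 - Q ^+ (n - k).+1) * B)
    + Q ^+ n.+1 * ((1 - Q ^+ n.+1) * D))); first by rewrite (exprS _ (n - k)) -/x; ring.
rewrite ab2 -ab1 xE; ring.
Qed.

Lemma capp_even j :
  capp j.*2 = qpoch (- q ^+ 2) (q ^+ 6) j * qpoch (- q ^+ 4) (q ^+ 6) j.
Proof.
elim: j => [|j IHj]; first by rewrite /qpoch !big_ord0 mulr1.
rewrite doubleS cappE IHj !qpochS -!exprM.
have -> : (3 * j.*2 = 6 * j)%N by lia.
rewrite !(exprD _ (6 * j)); ring.
Qed.

Lemma capp_odd j :
  capp j.*2.+1 = qpoch (- q) (q ^+ 6) j.+1 * qpoch (- q ^+ 5) (q ^+ 6) j.
Proof.
elim: j => [|j IHj].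
  by rewrite /qpoch big_ord1 big_ord0 expr0 !mulr1 opprK.
rewrite doubleS cappE IHj (qpochS _ _ j.+1) (qpochS (- q ^+ 5)) -!exprM.
have -> : (3 * j.*2.+1 + 2 = 6 * j + 5)%N by lia.
have -> : (3 * j.*2.+1 + 4 = 6 * j + 7)%N by lia.
have -> : (6 * j.+1 = 6 * j + 6)%N by lia.
rewrite !(exprD _ (6 * j)); ring.
Qed.

End Capparelli.

(** * Congruence of power series modulo $q^d$ *)

Section Truncation.
Variable R : comNzRingType.
Implicit Types f g h : fps R.

Definition eqdeg (d : nat) f g : Prop :=
  forall k, (k < d)%N -> coef f k = coef g k.

Lemma eqdeg_refl d f : eqdeg d f f. Proof. by []. Qed.

Lemma eqdeg_trans d f g h : eqdeg d f g -> eqdeg d g h -> eqdeg d f h.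
Proof. by move=> fg gh k kd; rewrite fg ?gh. Qed.

Lemma eqdegD d f g f' g' :
  eqdeg d f f' -> eqdeg d g g' -> eqdeg d (f + g) (f' + g').
Proof. by move=> ff gg k kd; rewrite !Defs.coefD ff ?gg. Qed.

Lemma eqdegM d f g f' g' :
  eqdeg d f f' -> eqdeg d g g' -> eqdeg d (f * g) (f' * g').
Proof.
move=> ff gg k kd; rewrite !Defs.coefM; apply: eq_bigr => i _.
have ik := ltn_ord i; rewrite ff ?gg //; lia.
Qed.

Lemma eqdeg_sum d n (F G : 'I_n -> fps R) :
  (forall i, eqdeg d (F i) (G i)) -> eqdeg d (\sum_i F i) (\sum_i G i).
Proof.
by move=> FG k kd; rewrite !Defs.coef_sum; apply: eq_bigr => i _; apply: FG.
Qed.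

Lemma eqdegX d f n : coef f 0 = 0 -> (d <= n)%N -> eqdeg d (f ^+ n) 0.
Proof. by move=> f0 dn k kd; rewrite coefXn_small ?Defs.coef0 //; lia. Qed.

Lemma eqdeg_qpoch_inf d (a q : fps R) n : coef q 0 = 0 -> (d <= n)%N ->
  eqdeg d (qpoch a q n) (qpoch_inf a q).
Proof.
move=> q0 dn k kd; rewrite [RHS]/coef /=.
have {d dn kd}: (k.+1 <= n)%N by lia.
elim: n => // n IHn; rewrite leq_eqVlt => /orP[/eqP-> //|kn].
rewrite -IHn // qpochS mulrBr mulr1 mulrA.
have := eqdegM (@eqdeg_refl n (qpoch a q n * a))
  (eqdegX q0 (leqnn n)).
by move=> /(_ k kn); rewrite mulr0 Defs.coef0 Defs.coefB => ->; rewrite subr0.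
Qed.

End Truncation.



(** * The double series $T(a,b)$ and its shift relations *)

Section DoubleSum.
Local Notation q := (fpsX : fps int).

(* The exponent 2m^2 + 6mn + 6n^2 - 2m - 3n + am + bn without subtraction. *)
Definition cexp (a b m n : nat) : nat :=
  4 * 'C(m, 2) + 6 * m * n + 3 * n + 12 * 'C(n, 2) + a * m + b * n.

Definition cterm (a b m n : nat) : fps int :=
  q ^+ cexp a b m n / (qpoch q q m * qpoch (q ^+ 3) (q ^+ 3) n).

(** For $a = 0$ the term $m = 1$, $n = 0$ has exponent 0, so at [d = 0] a cutoff [d.+1] would be too
    small. *)
Definition csum (a b : nat) : fps int :=
  FPS (fun d => \sum_(m < d.+2) \sum_(n < d.+2) coef (cterm a b m n) d).

Lemma coef_q0 e : coef (q ^+ e.+1) 0 = 0.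
Proof. by rewrite coef_fpsXn. Qed.

Lemma leq_bin2S n : (n <= 'C(n, 2).+1)%N.
Proof. by case: n => // n; rewrite binS bin1; lia. Qed.

Lemma coef_cterm a b m n d : (d.+2 <= m)%N || (d.+2 <= n)%N ->
  coef (cterm a b m n) d = 0.
Proof.
move=> mn; have e : (d < cexp a b m n)%N.
  by rewrite /cexp; have := leq_bin2S m; have := leq_bin2S n; lia.
rewrite /cterm; have := eqdegM (eqdegX (coef_q0 0) e) (@eqdeg_refl _ d.+1 _).
by move=> ->; rewrite // mul0r.
Qed.

Lemma cterm_has_sum a b : fps_has_sum2 (cterm a b) (csum a b).
Proof. by move=> d; exists d.+2; split=> // m n; apply: coef_cterm. Qed.

Lemma sum_ord_trunc M N (F : nat -> int) : (N <= M)%N ->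
  (forall m, (N <= m)%N -> F m = 0) -> \sum_(m < M) F m = \sum_(m < N) F m.
Proof.
move=> NM F0; rewrite -(subnKC NM) big_split_ord /= [X in _ + X]big1 ?addr0 //.
by move=> i _; rewrite F0 // leq_addr.
Qed.

Lemma coef_csum a b d M N : (d.+2 <= M)%N -> (d.+2 <= N)%N ->
  coef (csum a b) d = \sum_(m < M) \sum_(n < N) coef (cterm a b m n) d.
Proof.
move=> dM dN; rewrite [LHS]/coef /=.
rewrite -(sum_ord_trunc (F := fun m => \sum_(n < d.+2) coef (cterm a b m n) d) dM).
  apply: eq_bigr => m _; symmetry.
  apply: (sum_ord_trunc (F := fun n => coef (cterm a b m n) d) dN) => n dn.
  by rewrite coef_cterm // dn orbT.
by move=> m dm; rewrite big1 // => n _; rewrite coef_cterm // dm.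
Qed.

Lemma coef_mul_csum c a b d M N : (d.+2 <= M)%N -> (d.+2 <= N)%N ->
  coef (c * csum a b) d
  = \sum_(m < M) \sum_(n < N) coef (c * cterm a b m n) d.
Proof.
move=> dM dN; transitivity (coef (c * \sum_(m < M) \sum_(n < N) cterm a b m n) d).
  rewrite !Defs.coefM; apply: eq_bigr => i _; congr (_ * _).
  rewrite (@coef_csum _ _ _ M N) ?(leq_trans _ dM) ?(leq_trans _ dN) ?ltnS ?leq_subr //.
  by rewrite Defs.coef_sum; apply: eq_bigr => m _; rewrite Defs.coef_sum.
rewrite mulr_sumr Defs.coef_sum; apply: eq_bigr => m _.
by rewrite mulr_sumr Defs.coef_sum.
Qed.

Lemma unit_1subM (f g : fps int) : coef f 0 = 0 -> 1 - f * g \is a GRing.unit.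
Proof.
by move=> f0; rewrite unit_fpsE Defs.coefB coefM0 f0 mul0r Defs.coef1 subr0 unitr1.
Qed.

Lemma divr_mulr2 (A : comUnitRingType) (x u v : A) :
  u \is a GRing.unit -> v \is a GRing.unit -> x * u / (v * u) = x / v.
Proof. by move=> uU vU; rewrite invrM // mulrA mulrK. Qed.

Lemma qpoch_prod_unit m n :
  qpoch q q m * qpoch (q ^+ 3) (q ^+ 3) n \is a GRing.unit.
Proof.
by rewrite unitrM (@qpoch_fpsX_unit int 3) // (@qpoch_fpsX_unit int 1).
Qed.

Lemma cterm_m0 a b n : cterm a b 0 n = cterm a.+1 b 0 n.
Proof. by rewrite /cterm /cexp !muln0. Qed.

Lemma cterm_n0 a b m : cterm a b m 0 = cterm a (b + 3) m 0.
Proof. by rewrite /cterm /cexp !muln0. Qed.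

(** The two exponents differ by $m+1$, which produces $1-q^{m+1}$, the last factor of
    $(q;q)_{m+1}$. *)
Lemma cterm_mS a b m n :
  cterm a b m.+1 n - cterm a.+1 b m.+1 n = q ^+ a * cterm (a + 4) (b + 6) m n.
Proof.
rewrite /cterm -mulrBl mulrA qpochS mulrAC.
rewrite -[RHS](divr_mulr2 _ (unit_1subM (q ^+ m) (coef_q0 0))) ?qpoch_prod_unit //.
congr (_ / _); rewrite -exprS.
have -> : cexp a b m.+1 n = (a + cexp (a + 4) (b + 6) m n)%N.
  by rewrite /cexp binS bin1; lia.
have -> : cexp a.+1 b m.+1 n = (a + cexp (a + 4) (b + 6) m n + m.+1)%N.
  by rewrite /cexp binS bin1; lia.
by rewrite !exprD; ring.
Qed.

Lemma cterm_nS a b m n :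
  cterm a b m n.+1 - cterm a (b + 3) m n.+1
  = q ^+ (b + 3) * cterm (a + 6) (b + 12) m n.
Proof.
rewrite /cterm -mulrBl mulrA qpochS [X in _ / X]mulrA.
rewrite -[RHS](divr_mulr2 _ (unit_1subM (q ^+ 3 ^+ n) (coef_q0 2)))
  ?qpoch_prod_unit //.
congr (_ / _); rewrite -exprS -exprM.
have -> : cexp a b m n.+1 = (b + 3 + cexp (a + 6) (b + 12) m n)%N.
  by rewrite /cexp binS bin1; lia.
have -> : cexp a (b + 3) m n.+1 = (b + 3 + cexp (a + 6) (b + 12) m n + 3 * n.+1)%N.
  by rewrite /cexp binS bin1; lia.
by rewrite !exprD; ring.
Qed.

Lemma csum_a a b a1 a4 b6 : a1 = a.+1 -> a4 = (a + 4)%N -> b6 = (b + 6)%N ->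
  csum a b = csum a1 b + q ^+ a * csum a4 b6.
Proof.
move=> -> -> ->; apply/fpsP => d.
(* One extra value of [m] on the left: its terms at [m = 0] do not depend on [a] and cancel. *)
rewrite Defs.coefD !(@coef_csum _ _ _ d.+3 d.+2) //.
rewrite (@coef_mul_csum _ _ _ _ d.+2 d.+2) //; apply/eqP.
rewrite addrC -subr_eq; apply/eqP; rewrite -sumrB big_ord_recl -[X in X + _ = _]sumrB.
rewrite [X in X + _]big1 => [|n _]; last by rewrite cterm_m0 subrr.
rewrite add0r; apply: eq_bigr => m _; rewrite -sumrB; apply: eq_bigr => n _.
by rewrite lift0 -Defs.coefB cterm_mS.
Qed.

Lemma csum_b a b b3 a6 b12 :
  b3 = (b + 3)%N -> a6 = (a + 6)%N -> b12 = (b + 12)%N ->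
  csum a b = csum a b3 + q ^+ b3 * csum a6 b12.
Proof.
move=> -> -> ->; apply/fpsP => d.
rewrite Defs.coefD !(@coef_csum _ _ _ d.+2 d.+3) //.
rewrite (@coef_mul_csum _ _ _ _ d.+2 d.+2) //; apply/eqP.
rewrite addrC -subr_eq; apply/eqP; rewrite -sumrB; apply: eq_bigr => m _.
rewrite -sumrB big_ord_recl cterm_n0 subrr add0r; apply: eq_bigr => n _.
by rewrite lift0 -Defs.coefB cterm_nS.
Qed.

Lemma eqdeg_csum1 d a b : (d <= a)%N -> (d <= b)%N -> eqdeg d (csum a b) 1.
Proof.
move=> da db k kd; rewrite (@coef_csum _ _ _ k.+2 k.+2) //.
have c0 m n : (0 < m + n)%N -> coef (cterm a b m n) k = 0.
  move=> mn; have e : (k < cexp a b m n)%N by rewrite /cexp; nia.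
  rewrite /cterm; have := eqdegM (eqdegX (coef_q0 0) e) (@eqdeg_refl _ k.+1 _).
  by move=> ->; rewrite // mul0r.
rewrite big_ord_recl [X in _ + X]big1 => [|m _]; last first.
  by rewrite big1 // => n _; rewrite c0.
rewrite big_ord_recl [X in _ + X + _]big1 => [|n _]; last by rewrite c0.
have -> : cterm a b 0 0 = 1; last by rewrite !addr0.
by rewrite /cterm /cexp /qpoch !big_ord0 !muln0 mulr1 invr1 mulr1.
Qed.

(** * The linear system for $A_n$ and $B_n$ *)

Definition csA n := csum (3 * n + 2) (6 * n + 3).
Definition csB n := csum (3 * n + 3) (6 * n + 6).

Lemma q6E n : q ^+ (6 * n) = q ^+ (3 * n) * q ^+ (3 * n).
Proof. by rewrite -exprD; congr (_ ^+ _); lia. Qed.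

(** In terms of partitions: no part $3n+2$; smallest part $3n+2$ and the next at least $3n+6$; or
    smallest parts $3n+2$, $3n+4$. *)
Lemma csA_rec n : csA n = csB n + q ^+ (3 * n + 2) * csB n.+1
  + q ^+ (6 * n + 6) * csA n.+2.
Proof.
rewrite /csA /csB.
have -> : (3 * n.+1 + 3 = 3 * n + 6)%N by lia.
have -> : (6 * n.+1 + 6 = 6 * n + 12)%N by lia.
have -> : (3 * n.+2 + 2 = 3 * n + 8)%N by lia.
have -> : (6 * n.+2 + 3 = 6 * n + 15)%N by lia.
rewrite (@csum_a (3 * n + 2) _ (3 * n + 3) (3 * n + 6) (6 * n + 9)); try lia.
rewrite (@csum_b (3 * n + 3) (6 * n + 3) (6 * n + 6) (3 * n + 9) (6 * n + 15)); try lia.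
rewrite (@csum_b (3 * n + 6) (6 * n + 9) (6 * n + 12) (3 * n + 12) (6 * n + 21)); try lia.
rewrite (@csum_a (3 * n + 8) _ (3 * n + 9) (3 * n + 12) (6 * n + 21)); try lia.
rewrite !(exprD _ (3 * n)) !(exprD _ (6 * n)) q6E; ring.
Qed.

(** Partitions sorted by smallest part: at least $3n+5$, equal to $3n+4$, or equal to $3n+3$. *)
Lemma csB_rec n : csB n = csA n.+1 + q ^+ (3 * n + 4) * csA n.+2
  + q ^+ (3 * n + 3) * csB n.+1.
Proof.
rewrite /csA /csB.
have -> : (3 * n.+1 + 3 = 3 * n + 6)%N by lia.
have -> : (6 * n.+1 + 6 = 6 * n + 12)%N by lia.
have -> : (3 * n.+1 + 2 = 3 * n + 5)%N by lia.
have -> : (6 * n.+1 + 3 = 6 * n + 9)%N by lia.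
have -> : (3 * n.+2 + 2 = 3 * n + 8)%N by lia.
have -> : (6 * n.+2 + 3 = 6 * n + 15)%N by lia.
rewrite (@csum_a (3 * n + 3) _ (3 * n + 4) (3 * n + 7) (6 * n + 12)); try lia.
rewrite (@csum_a (3 * n + 4) _ (3 * n + 5) (3 * n + 8) (6 * n + 12)); try lia.
rewrite (@csum_b (3 * n + 5) (6 * n + 6) (6 * n + 9) (3 * n + 11) (6 * n + 18)); try lia.
rewrite (@csum_b (3 * n + 8) (6 * n + 12) (6 * n + 15) (3 * n + 14) (6 * n + 24)); try lia.
rewrite (@csum_a (3 * n + 6) _ (3 * n + 7) (3 * n + 10) (6 * n + 18)); try lia.
rewrite (@csum_a (3 * n + 10) _ (3 * n + 11) (3 * n + 14) (6 * n + 24)); try lia.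
rewrite !(exprD _ (3 * n)) !(exprD _ (6 * n)) q6E; ring.
Qed.

Lemma csum00 : csum 0 0 = csA 0 + csB 0 + q * csA 1.
Proof.
rewrite /csA /csB.
rewrite (@csum_a 0 0 1 4 6) // (@csum_a 1 0 2 5 6) // (@csum_b 2 0 3 8 12) //=.
rewrite (@csum_b 5 6 9 11 18) // (@csum_a 3 6 4 7 12) // (@csum_a 7 12 8 11 18) //.
ring.
Qed.

(** * The invariant pairing with the adjoint solution *)

Definition pairing n :=
  capu q n.+1 * csA n.+1
  + (capu q n.+2 - capu q n.+1 - q ^+ 2 * (q ^+ 3) ^+ n * capw q n.+1) * csA n.+2
  + q ^+ 2 * (q ^+ 3) ^+ n * capw q n.+1 * csB n.+1.

Lemma capu_recE n : capu q n.+2 = capu q n.+1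
  - (q ^+ 3) ^+ n.+1 * (1 - (q ^+ 3) ^+ n.+1) * capu q n
  + (1 + q) * q ^+ 2 * (q ^+ 3) ^+ n * capw q n.+1.
Proof. by rewrite -capu_rec; ring. Qed.

(** Eliminating $A_{n+1}$ and $B_{n+1}$ from [pairing n] leaves $A_{n+2}$, $A_{n+3}$, $B_{n+2}$,
    whose coefficients match by the recurrences of [capu] and [capw]. *)
Lemma pairingS n : pairing n.+1 = pairing n.
Proof.
rewrite /pairing (csA_rec n.+1) (csB_rec n.+1) (capu_recE n.+1) (capwS _ n.+1).
have -> : (6 * n.+1 + 6 = 3 * n + (3 * n + 12))%N by lia.
have -> : (3 * n.+1 = 3 * n + 3)%N by lia.
rewrite !(exprD _ (3 * n + 3)) !(exprD _ (3 * n)) !(exprM _ 3 n) !(exprS (q ^+ 3)).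
ring.
Qed.

Lemma pairing0 : pairing 0 = csum 0 0.
Proof.
rewrite csum00 /pairing (csA_rec 0) (csB_rec 0) capu_recE capwS.
rewrite /capu /capw gsumS !gsum0 /= muln0 !add0n; ring.
Qed.

Lemma pairingE n : pairing n = csum 0 0.
Proof. by elim: n => [|n IHn]; rewrite ?pairing0 ?pairingS. Qed.

Lemma eqdeg_pairing d n : (d <= n)%N -> eqdeg d (pairing n) (capu q n.+1).
Proof.
move=> dn.
have xn : eqdeg d ((q ^+ 3) ^+ n) 0 by apply: eqdegX (coef_q0 2) dn.
(* By [capu_recE] everything except the $A_{n+1}$ term is divisible by $Q^n$. *)
have -> : pairing n = capu q n.+1 * csA n.+1 + (q ^+ 3) ^+ n *
   (((1 + q) * q ^+ 2 * capw q n.+1 - q ^+ 3 * (1 - (q ^+ 3) ^+ n.+1) * capu q n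
     - q ^+ 2 * capw q n.+1) * csA n.+2 + q ^+ 2 * capw q n.+1 * csB n.+1).
  by rewrite /pairing capu_recE (exprS (q ^+ 3)); ring.
apply: eqdeg_trans (eqdegD (eqdegM (@eqdeg_refl _ d _) (@eqdeg_csum1 d _ _ _ _))
  (eqdegM xn (@eqdeg_refl _ d _))) _; try lia.
by rewrite mulr1 mul0r addr0.
Qed.

(** * The limit of $u_n$ and the product side *)

Let pe := qpochs_inf [:: - q ^+ 2; - q ^+ 4] (q ^+ 6).
Let po := qpochs_inf [:: - q; - q ^+ 5] (q ^+ 6).
Let p_inf k := if odd k then po else pe.

Lemma eqdeg_capp d k : (d.*2 < k)%N -> eqdeg d (capp q k) (p_inf k).
Proof.
have q6 := coef_q0 5.
rewrite /p_inf /pe /po /qpochs_inf !big_cons !big_nil !mulr1.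
rewrite -{1 2}(odd_double_half k); case: (odd k) => dk.
  by rewrite add1n capp_odd; apply: eqdegM; apply: eqdeg_qpoch_inf => //; lia.
by rewrite add0n capp_even; apply: eqdegM; apply: eqdeg_qpoch_inf => //; lia.
Qed.

Lemma eqdeg_capu d n : (3 * d < n)%N ->
  eqdeg d (capu q n.+1) ((pe + po) * qpoch_inf (- q ^+ 3) (q ^+ 3)).
Proof.
move=> dn; apply: (@eqdeg_trans _ _ _ (gsum (q ^+ 3) p_inf n.+1)).
  (* For $k > 2d$ the factor $p_k$ is already at its limit modulo $q^d$; for $k \le 2d$ the bound $n
     > 3d$ makes the power of $Q$ vanish modulo $q^d$. *)
  apply: eqdeg_sum => k; have [kd|dk] := leqP k d.*2; last first.
    exact: eqdegM (@eqdeg_refl _ d _) (eqdeg_capp dk).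
  have x0 : eqdeg d ((q ^+ 3) ^+ 'C(n.+1 - k, 2)) 0.
    by apply: eqdegX (coef_q0 2) _; have := leq_bin2S (n.+1 - k); lia.
  have z f g : eqdeg d (f * (q ^+ 3) ^+ 'C(n.+1 - k, 2) * g) 0.
    have := eqdegM (eqdegM (@eqdeg_refl _ d f) x0) (@eqdeg_refl _ d g).
    by rewrite mulr0 mul0r.
  by move=> i id; rewrite !z.
rewrite gsum_periodic => [|k]; last by rewrite /p_inf /= negbK.
by apply: eqdegM => //; apply: eqdeg_qpoch_inf (coef_q0 2) _; lia.
Qed.

Lemma csum00_prod : csum 0 0 = (pe + po) * qpoch_inf (- q ^+ 3) (q ^+ 3).
Proof.
apply/fpsP => k; rewrite -(pairingE (3 * k.+1).+1).
rewrite (@eqdeg_pairing k.+1) //; last by lia.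
by apply: (@eqdeg_capu k.+1).
Qed.

End DoubleSum.

Theorem theorem1p2 :
  let q : fps int := fpsX in
  fps_has_sum2
    (fun m n : nat =>
       q ^+ (2 * m ^ 2 + 6 * m * n + 6 * n ^ 2 - 2 * m - 3 * n)
         / (qpoch q q m * qpoch (q ^+ 3) (q ^+ 3) n))
    (qpochs_inf [:: - q ^+ 2; - q ^+ 4] (q ^+ 6)
       * qpochs_inf [:: - q ^+ 3] (q ^+ 3)
     + qpochs_inf [:: - q; - q ^+ 5] (q ^+ 6)
       * qpochs_inf [:: - q ^+ 3] (q ^+ 3)).
Proof.
move=> q; rewrite -mulrDl [X in _ * X]/qpochs_inf big_seq1 -csum00_prod.
move=> d; have [N [N0 NS]] := cterm_has_sum 0 0 d.
have expE m n : (2 * m ^ 2 + 6 * m * n + 6 * n ^ 2 - 2 * m - 3 * n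
    = cexp 0 0 m n)%N.
  (* This turns $2m^2-2m$ into $4C(m,2)$ and $6n^2-3n$ into $12C(n,2)+3n$, removing the
     subtractions. *)
  have bin2E k : (2 * 'C(k, 2) + k = k ^ 2)%N.
    by elim: k => // k; rewrite binS bin1; lia.
  by rewrite /cexp -!bin2E; lia.
exists N; split=> [m n mn|]; first by rewrite expE N0.
by rewrite NS; apply: eq_bigr => m _; apply: eq_bigr => n _; rewrite expE.
Qed.
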